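(* Let $p$ be a prime and let $n, d, m \in \mathbb{N}$. Let $\{\tau_j\}_{j=1}^n$ be any collection in $\mathbb{Q}_p^d$ such that there exists $b \in \mathbb{Q}_p$ satisfying $$\sum_{j=1}^{n}\langle x, \tau_j^{\otimes m}\rangle\, \tau_j^{\otimes m} = bx, \quad \forall x \in \text{Sym}^m(\mathbb{Q}_p^d).$$ Then $$\max_{1\leq j,k \leq n,\ j \neq k}\left\{\left| \sum_{l=1}^n\langle \tau_l,\tau_l\rangle^{2m} \right|,\ |\langle \tau_j,\tau_k\rangle|^{2m}\right\}\geq \frac{1}{\left|\binom{d+m-1}{m}\right|}\left|\sum_{j=1}^n\langle \tau_j, \tau_j \rangle^m \right|^2.$$ In particular, if $\langle \tau_j, \tau_j\rangle =1$ for all $1\leq j \leq n$, then $$\max_{1\leq j,k \leq n,\ j \neq k}\{|n|,\ |\langle \tau_j, \tau_k\rangle|^{2m} \}\geq \frac{|n|^2}{\left|\binom{d+m-1}{m}\right|}.$$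
   Context: $\mathbb{N}$ denotes the positive integers. $\mathbb{Q}_p$ is the field of $p$-adic numbers and $|\cdot|$ is the $p$-adic absolute value on $\mathbb{Q}_p$; integers such as $n$ and $\binom{d+m-1}{m}$ are regarded as elements of $\mathbb{Q}_p$, so $|n|$ and $\left|\binom{d+m-1}{m}\right|$ are $p$-adic absolute values. The space $\mathbb{Q}_p^d$ carries the symmetric bilinear form (called the inner product) $\langle (a_j)_{j=1}^d,(b_j)_{j=1}^d\rangle := \sum_{j=1}^d a_jb_j$. $\text{Sym}^m(\mathbb{Q}_p^d)\subseteq (\mathbb{Q}_p^d)^{\otimes m}$ is the $\mathbb{Q}_p$-vector space of symmetric $m$-tensors, with the bilinear form $\langle\cdot,\cdot\rangle$ restricted from the one on $(\mathbb{Q}_p^d)^{\otimes m}$ determined by $\langle x_1\otimes\cdots\otimes x_m,\ y_1\otimes\cdots\otimes y_m\rangle=\prod_{i=1}^m\langle x_i,y_i\rangle$; in particular $\langle x^{\otimes m},y^{\otimes m}\rangle=\langle x,y\rangle^m$. For $\tau\in\mathbb{Q}_p^d$, $\tau^{\otimes m}=\tau\otimes\cdots\otimes\tau$ ($m$ factors). The notation $\max_{1\leq j,k\leq n,\ j\neq k}\{A, B_{j,k}\}$ means the maximum of the finite set consisting of the real number $A$ together with all the real numbers $B_{j,k}$ for $1\leq j,k\leq n$, $j\neq k$ (so it equals $A$ when $n=1$). *)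

(* Defs.v *)
From HB Require Import structures.
From mathcomp Require Import all_boot all_order all_fingroup all_algebra.
From mathcomp Require Import ring_quotient generic_quotient.
From mathcomp Require Import all_classical all_reals all_analysis.

Set Implicit Arguments.
Unset Strict Implicit.
Unset Printing Implicit Defensive.

Import Order.TTheory GRing.Theory Num.Theory.
Import numFieldNormedType.Exports.
Local Open Scope quotient_scope.
Local Open Scope ring_scope.

Definition padic_val (p : nat) (x : rat) : int :=
  (logn p `|numq x|%N)%:Z - (logn p `|denq x|%N)%:Z.

Definition padic_norm (p : nat) (x : rat) : rat :=
  if x == 0 then 0 else p%:R ^ (- padic_val p x).

Section PadicNorm.
Variables (p : nat) (p_pr : prime p).
Local Notation N := (padic_norm p).
Local Notation v := (padic_val p).

Let p_gt0 : 0 < p%:R :> rat.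
Proof. by rewrite ltr0n prime_gt0. Qed.

Let p_gt1 : 1 < p%:R :> rat.
Proof. by rewrite ltr1n prime_gt1. Qed.

Lemma padic_norm0 : N 0 = 0.
Proof. by rewrite /padic_norm eqxx. Qed.

Lemma padic_val_frac (a b : int) : a != 0 -> b != 0 ->
  v (a%:~R / b%:~R) = (logn p `|a|%N)%:Z - (logn p `|b|%N)%:Z.
Proof.
move=> a0 b0; set x := a%:~R / b%:~R; rewrite /padic_val.
have x0 : x != 0 by rewrite mulf_neq0 ?invr_eq0 ?intr_eq0.
have E : (numq x * b = a * denq x)%R.
  apply: (@intr_inj rat); rewrite !intrM numqE /x.
  by rewrite mulrAC divfK ?intr_eq0.
have /(congr1 (logn p)) : (`|numq x| * `|b| = `|a| * `|denq x|)%N.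
  by rewrite -!abszM E.
rewrite !lognM ?absz_gt0 ?denq_eq0 ?numq_eq0 // => EE.
apply/eqP; rewrite subr_eq addrAC eq_sym subr_eq.
by rewrite -!PoszD EE.
Qed.

Lemma padic_norm_ge0 x : 0 <= N x.
Proof. by rewrite /padic_norm; case: ifP => // _; rewrite exprz_ge0 // ltW. Qed.

Lemma padic_norm_eq0 x : (N x == 0) = (x == 0).
Proof.
rewrite /padic_norm; case: ifP => [_|_]; first by rewrite eqxx.
by rewrite expfz_eq0 (gt_eqF p_gt0) andbF.
Qed.

Lemma padic_norm_gt0 x : (0 < N x) = (x != 0).
Proof. by rewrite lt_def padic_norm_ge0 andbT padic_norm_eq0. Qed.

Lemma padic_norm1 : N 1 = 1.
Proof. by rewrite /padic_norm oner_eq0 /padic_val (numq_int 1) (denq_int 1) subrr. Qed.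

Lemma padic_normN x : N (- x) = N x.
Proof. by rewrite /padic_norm oppr_eq0 /padic_val numqN denqN abszN. Qed.

Lemma padic_normM x y : N (x * y) = N x * N y.
Proof.
have [->|x0] := eqVneq x 0; first by rewrite mul0r padic_norm0 mul0r.
have [->|y0] := eqVneq y 0; first by rewrite mulr0 padic_norm0 mulr0.
rewrite /padic_norm mulf_eq0 (negPf x0) (negPf y0) /=.
rewrite -expfzDr ?(gt_eqF p_gt0)// -opprD; congr (_ ^ (- _)).
rewrite -{1}(divq_num_den x) -{1}(divq_num_den y) mulf_div -!intrM.
rewrite padic_val_frac ?mulf_neq0 ?numq_eq0 ?denq_eq0 //.
rewrite /padic_val !abszM !lognM ?absz_gt0 ?numq_eq0 ?denq_eq0 //.
by rewrite !PoszD opprD addrACA.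
Qed.

Lemma padic_normV x : N x^-1 = (N x)^-1.
Proof.
have [->|x0] := eqVneq x 0; first by rewrite !(invr0, padic_norm0).
have nx0 : N x != 0 by rewrite padic_norm_eq0.
by apply: (mulfI nx0); rewrite mulfV // -padic_normM mulfV // padic_norm1.
Qed.

Let ultra_int (a c : int) : a != 0 -> c != 0 -> a + c != 0 ->
  (minn (logn p `|a|%N) (logn p `|c|%N) <= logn p `|(a + c)%R|%N)%N.
Proof.
move=> a0 c0 ac0; rewrite -pfactor_dvdn ?absz_gt0 //.
set k := minn _ _.
have dv (z : int) : z != 0 -> (k <= logn p `|z|%N)%N -> ((p ^ k)%N%:Z %| z)%Z.
  by move=> z0; rewrite dvdzE /= pfactor_dvdn ?absz_gt0.
suff : ((p ^ k)%N%:Z %| a + c)%Z by rewrite dvdzE.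
by rewrite rpredD ?dv ?geq_minl ?geq_minr.
Qed.

Lemma padic_normD x y : N (x + y) <= Num.max (N x) (N y).
Proof.
have [->|x0] := eqVneq x 0; first by rewrite add0r le_max lexx orbT.
have [->|y0] := eqVneq y 0; first by rewrite addr0 le_max lexx.
have [->|xy0] := eqVneq (x + y) 0.
  by rewrite padic_norm0 le_max padic_norm_ge0.
pose a := numq x * denq y; pose c := numq y * denq x; pose d := denq x * denq y.
have dx0 := denq_neq0 x; have dy0 := denq_neq0 y.
have a0 : a != 0 by rewrite mulf_neq0 ?numq_eq0.
have c0 : c != 0 by rewrite mulf_neq0 ?numq_eq0.
have d0 : d != 0 by rewrite mulf_neq0.
have Ex : x = a%:~R / d%:~R.
  by rewrite !intrM -mulf_div divff ?intr_eq0 // mulr1 divq_num_den.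
have Ey : y = c%:~R / d%:~R.
  rewrite /d (mulrC (denq x)) !intrM -mulf_div divff ?intr_eq0 // mulr1.
  by rewrite divq_num_den.
have Exy : x + y = (a + c)%:~R / d%:~R by rewrite intrD mulrDl -Ex -Ey.
have ac0 : a + c != 0.
  by apply: contraNneq xy0 => ac; rewrite Exy ac mul0r.
rewrite /padic_norm (negPf xy0) (negPf x0) (negPf y0) Exy Ex Ey.
rewrite !padic_val_frac // le_max !ler_eXz2l //.
rewrite !lerN2 !lerD2r !lez_nat -geq_min.
exact: ultra_int.
Qed.

Lemma padic_normB x y : N (x - y) <= Num.max (N x) (N y).
Proof. by rewrite -[N y]padic_normN padic_normD. Qed.

End PadicNorm.

(* The unused primality proof p_pr is an argument so that the algebraic
   structures below, which need it, can be inferred from the type. *)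
Definition padic_cauchy (p : nat) (p_pr : prime p) (u : nat -> rat) : bool :=
  `[< forall e : rat, 0 < e -> exists K : nat, forall m n : nat,
      (K <= m)%N -> (K <= n)%N -> padic_norm p (u m - u n) < e >].

Section PadicCauchy.
Variables (p : nat) (p_pr : prime p).
Local Notation N := (padic_norm p).

Lemma padic_cauchyP (u : nat -> rat) : reflect
  (forall e : rat, 0 < e -> exists K : nat, forall m n : nat,
      (K <= m)%N -> (K <= n)%N -> N (u m - u n) < e) (padic_cauchy p_pr u).
Proof. exact: asboolP. Qed.

Lemma padic_cauchy_bounded u : padic_cauchy p_pr u ->
  exists2 M : rat, 0 < M & forall n, N (u n) <= M.
Proof.
move=> /padic_cauchyP /(_ 1 ltr01)[K HK].
exists (1 + \sum_(i < K.+1) N (u i)).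
  by rewrite ltr_pwDl // sumr_ge0 // => i _; rewrite padic_norm_ge0.
have S i : (i < K.+1)%N -> N (u i) <= 1 + \sum_(i < K.+1) N (u i).
  move=> iK; rewrite (bigD1 (Ordinal iK)) //= addrCA lerDl.
  by rewrite addr_ge0 // sumr_ge0 // => j _; rewrite padic_norm_ge0.
move=> n; have [nK|Kn] := ltnP n K.+1; first exact: S.
rewrite -(subrK (u K) (u n)) (le_trans (padic_normD p_pr _ _)) // ge_max.
rewrite (S K) // andbT (le_trans (ltW (HK _ _ (ltnW Kn) (leqnn K)))) //.
by rewrite lerDl sumr_ge0 // => j _; rewrite padic_norm_ge0.
Qed.

Lemma padic_cauchy_subring : subring_closed (padic_cauchy p_pr).
Proof.
split.
- apply/padic_cauchyP => e e0; exists 0%N => m n _ _.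
  by rewrite subrr padic_norm0.
- move=> f g /padic_cauchyP cf /padic_cauchyP cg.
  apply/padic_cauchyP => e e0.
  have [K HK] := cf e e0; have [L HL] := cg e e0.
  exists (maxn K L) => m n; rewrite !geq_max => /andP[Km Lm] /andP[Kn Ln].
  have -> : (f - g) m - (f - g) n = (f m - f n) - (g m - g n).
    rewrite -[(f - g) m]/(f m - g m) -[(f - g) n]/(f n - g n).
    by rewrite !opprB addrACA [in RHS]addrACA [- g m + _]addrC [- f n + _]addrC.
  by rewrite (le_lt_trans (padic_normB p_pr _ _)) // gt_max HK ?HL.
- move=> f g cf cg.
  have [A A0 HA] := padic_cauchy_bounded cf.
  have [B B0 HB] := padic_cauchy_bounded cg.
  move/padic_cauchyP in cf; move/padic_cauchyP in cg.
  apply/padic_cauchyP => e e0.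
  have [K HK] := cf (e / B) (divr_gt0 e0 B0).
  have [L HL] := cg (e / A) (divr_gt0 e0 A0).
  exists (maxn K L) => m n; rewrite !geq_max => /andP[Km Lm] /andP[Kn Ln].
  have -> : (f * g) m - (f * g) n = (f m - f n) * g m + f n * (g m - g n).
    rewrite -[(f * g) m]/(f m * g m) -[(f * g) n]/(f n * g n).
    by rewrite mulrBl mulrBr addrA subrK.
  rewrite (le_lt_trans (padic_normD p_pr _ _)) // gt_max !padic_normM //.
  apply/andP; split.
    rewrite (@le_lt_trans _ _ (N (f m - f n) * B)) //.
      by rewrite ler_wpM2l // padic_norm_ge0.
    by rewrite -ltr_pdivlMr // HK.
  rewrite (@le_lt_trans _ _ (A * N (g m - g n))) //.
    by rewrite ler_wpM2r // padic_norm_ge0.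
  by rewrite mulrC -ltr_pdivlMr // HL.
Qed.

HB.instance Definition _ :=
  GRing.isSubringClosed.Build (nat -> rat) (padic_cauchy p_pr)
    padic_cauchy_subring.

Record padic_seq := PadicSeq
  { padic_seq_val :> nat -> rat ; _ : padic_cauchy p_pr padic_seq_val }.

HB.instance Definition _ := [isSub for padic_seq_val].
HB.instance Definition _ := [Choice of padic_seq by <:].
HB.instance Definition _ := [SubChoice_isSubComNzRing of padic_seq by <:].

Definition padic_null (u : padic_seq) : bool :=
  `[< forall e : rat, 0 < e -> exists K : nat, forall n : nat,
      (K <= n)%N -> N (u n) < e >].

Lemma padic_nullP (u : padic_seq) : reflect
  (forall e : rat, 0 < e -> exists K : nat, forall n : nat,
      (K <= n)%N -> N (u n) < e) (padic_null u).
Proof. exact: asboolP. Qed.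

Lemma padic_null_ideal : idealr_closed padic_null.
Proof.
split.
- apply/padic_nullP => e e0; exists 0%N => n _.
  by rewrite [X in N X](_ : _ = 0) ?padic_norm0.
- apply/negP => /padic_nullP /(_ 1 ltr01)[K /(_ K (leqnn K))].
  by rewrite [X in N X](_ : _ = 1) ?padic_norm1 ?ltxx.
- move=> f u w /padic_nullP nu /padic_nullP nw; apply/padic_nullP => e e0.
  have [M M0 HM] := padic_cauchy_bounded (valP f).
  have [K HK] := nu (e / M) (divr_gt0 e0 M0); have [L HL] := nw e e0.
  exists (maxn K L) => n; rewrite geq_max => /andP[Kn Ln].
  have -> : (f * u + w) n = f n * u n + w n by [].
  rewrite (le_lt_trans (padic_normD p_pr _ _)) // gt_max HL // andbT.
  rewrite padic_normM // (@le_lt_trans _ _ (M * N (u n))) //.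
    by rewrite ler_wpM2r ?padic_norm_ge0 // HM.
  by rewrite mulrC -ltr_pdivlMr // HK.
Qed.

HB.instance Definition _ := isIdealr.Build padic_seq padic_null padic_null_ideal.

(* Q_p as the completion of Q: Cauchy sequences modulo null sequences. *)
Definition padic := {ideal_quot (Idealr.clone padic_seq padic_null _)}.

HB.instance Definition _ := GRing.ComNzRing.on padic.
HB.instance Definition _ := EqQuotient.on padic.
HB.instance Definition _ := NzRingQuotient.on padic.

Lemma padic_nonnull_bound (u : padic_seq) : ~~ padic_null u ->
  exists2 e : rat, 0 < e & exists K, forall n, (K <= n)%N -> e <= N (u n).
Proof.
move=> /padic_nullP nu.
have [e e0 He] : exists2 e : rat, 0 < e &
    forall K, exists2 n, (K <= n)%N & e <= N (u n).
  apply: contrapT => H; apply: nu => e e0; apply: contrapT => H'.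
  apply: H; exists e => // K; apply: contrapT => H''; apply: H'; exists K => n Kn.
  by rewrite ltNge; apply/negP => en; apply: H''; exists n.
exists e => //; have /padic_cauchyP /(_ e e0)[K HK] := valP u.
exists K => n Kn; have [m Km em] := He K.
have : N (u m) <= Num.max (N (u m - u n)) (N (u n)).
  by rewrite -{1}(subrK (u n) (u m)) padic_normD.
rewrite le_max => /orP[|]; last exact: le_trans.
by move=> /(le_trans em); rewrite leNgt HK.
Qed.

Lemma padic_pi_eq (u w : padic_seq) :
  (\pi_padic u == \pi_padic w) = padic_null (u - w).
Proof. by rewrite -(Quotient.idealrBE (Idealr.clone padic_seq padic_null _)). Qed.

Lemma padic_inv_cauchy (u : padic_seq) : ~~ padic_null u ->
  padic_cauchy p_pr (fun n => (u n)^-1).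
Proof.
move=> /padic_nonnull_bound[e e0 [K HK]].
apply/padic_cauchyP => d d0.
have /padic_cauchyP /(_ _ (mulr_gt0 d0 (mulr_gt0 e0 e0)))[L HL] := valP u.
exists (maxn K L) => m n; rewrite !geq_max => /andP[Km Lm] /andP[Kn Ln].
have um0 : 0 < N (u m) by exact: lt_le_trans e0 (HK _ Km).
have un0 : 0 < N (u n) by exact: lt_le_trans e0 (HK _ Kn).
have -> : (u m)^-1 - (u n)^-1 = (u n - u m) * ((u m)^-1 * (u n)^-1).
  rewrite padic_norm_gt0 // in um0; rewrite padic_norm_gt0 // in un0.
  by rewrite mulrBl mulrCA mulfV // mulr1 mulrA mulfV // mul1r.
rewrite !padic_normM // !padic_normV // -invfM ltr_pdivrMr ?mulr_gt0 //.
rewrite (lt_le_trans (HL _ _ Ln Lm)) // ler_pM2l // ler_pM ?HK //; exact: ltW.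
Qed.

Lemma padic_inv_ex (x : padic) : x != 0 -> exists y : padic, y * x = 1.
Proof.
rewrite -[x]reprK -[0](rmorph0 \pi_padic) padic_pi_eq subr0; set u := repr x => u0.
exists (\pi_padic (PadicSeq (padic_inv_cauchy u0))); apply/eqP.
rewrite -(rmorph1 \pi_padic) -rmorphM padic_pi_eq; apply/padic_nullP => d d0.
have [e e0 [K HK]] := padic_nonnull_bound u0; exists K => n Kn.
rewrite [X in N X](_ : _ = 0) ?padic_norm0 //.
rewrite -[LHS]/((u n)^-1 * u n - 1) mulVf ?subrr //.
by rewrite -(padic_norm_gt0 p_pr) (lt_le_trans e0) ?HK.
Qed.

Definition padic_inv (x : padic) : padic := xget 0 [set y : padic | y * x = 1]%classic.

Lemma padic_mulVf (x : padic) : x != 0 -> padic_inv x * x = 1.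
Proof.
by move=> /padic_inv_ex[y xy]; rewrite /padic_inv; case: xgetP => // /(_ y).
Qed.

Lemma padic_inv0 : padic_inv 0 = 0.
Proof.
rewrite /padic_inv; case: xgetP => //= y _ /eqP.
by rewrite mulr0 eq_sym oner_eq0.
Qed.

HB.instance Definition _ :=
  GRing.ComNzRing_isField.Build padic padic_mulVf padic_inv0.

(* By padic_absE the limit exists and does not depend on the representative. *)
Definition padic_abs (R : realType) (x : padic) : R :=
  (lim ((ratr (N (repr x n)) : R) @[n --> \oo]))%classic.

Lemma padic_norm_dist (x y : rat) : `|N x - N y| <= N (x - y).
Proof.
have H a b : N a - N b <= N (a - b).
  rewrite lerBlDr -{1}(subrK b a) (le_trans (padic_normD p_pr _ _)) //.
  by rewrite ge_max lerDl lerDr !padic_norm_ge0.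
by rewrite ler_norml H lerNl opprB -(padic_normN p (x - y)) opprB H.
Qed.

Lemma padic_null_cvg (R : realType) (u : padic_seq) : padic_null u ->
  ((ratr (N (u n)) : R) @[n --> \oo] --> (0 : R))%classic.
Proof.
move=> /padic_nullP nu; apply/cvgrPdist_lt => e e0.
have [k ke] : exists k : nat, (k.+1%:R^-1 : R) < e.
  by exists (Num.truncn e^-1); rewrite invf_plt ?posrE // truncnS_gt.
have [K HK] := nu k.+1%:R^-1 ltac:(by rewrite invr_gt0 ltr0n).
near=> n; rewrite sub0r normrN -ratr_norm ger0_norm ?padic_norm_ge0 //.
rewrite (lt_trans _ ke) // -(ratr_nat R) -fmorphV ltr_rat HK //.
by near: n; exact: nbhs_infty_ge.
Unshelve. all: by end_near. Qed.

Lemma padic_norm_cvg (R : realType) (u : padic_seq) :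
  cvgn (fun n => ratr (N (u n)) : R).
Proof.
have [nu|nu] := boolP (padic_null u).
  by apply/cvg_ex; exists 0; exact: padic_null_cvg.
have [e e0 [K HK]] := padic_nonnull_bound nu.
have /padic_cauchyP /(_ e e0)[L HL] := valP u.
apply/cvg_ex; exists (ratr (N (u (maxn K L)))).
apply: cvg_near_cst; near=> n.
have Kn : (maxn K L <= n)%N by near: n; exact: nbhs_infty_ge.
congr (ratr _).
move: Kn; rewrite geq_max => /andP[Kn Ln]; set m := maxn K L.
have Hmax : forall a b : rat, e <= N a -> N (b - a) < e -> N b <= N a.
  move=> a b ea ba; rewrite -(subrK a b) (le_trans (padic_normD p_pr _ _)) //.
  by rewrite ge_max lexx andbT (ltW (lt_le_trans ba ea)).
apply/eqP; rewrite eq_le !Hmax ?HK ?HL // ?leq_maxl ?leq_maxr //.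
Unshelve. all: by end_near. Qed.

Lemma padic_absE (R : realType) (u : padic_seq) :
  ((ratr (N (u n)) : R) @[n --> \oo] --> padic_abs R (\pi_padic u))%classic.
Proof.
rewrite /padic_abs; set w := repr _.
have nuw : padic_null (u - w) by rewrite -padic_pi_eq reprK.
apply: (cvg_sub0 _ (@padic_norm_cvg R w)); apply: norm_cvg0.
apply: (@squeeze_cvgr _ _ _ _ (cst 0) (fun n => ratr (N ((u - w) n)))).
- apply: nearW => n; rewrite normr_ge0 /=.
  rewrite -[X in `|X|]/(ratr (N (u n)) - ratr (N (w n)) : R).
  by rewrite -rmorphB -ratr_norm ler_rat padic_norm_dist.
- exact: cvg_cst.
- exact: padic_null_cvg.
Qed.

Lemma padic_abs_unique (R : realType) (u : padic_seq) (l : R) :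
  ((ratr (N (u n)) : R) @[n --> \oo] --> l)%classic ->
  padic_abs R (\pi_padic u) = l.
Proof. by move=> ul; rewrite -(cvg_lim _ ul) // (cvg_lim _ (@padic_absE R u)). Qed.

Lemma padic_abs_int (R : realType) (z : int) :
  padic_abs R z%:~R = ratr (N z%:~R).
Proof.
rewrite -(rmorph_int \pi_padic); apply: padic_abs_unique.
rewrite (_ : (fun n => _) = cst (ratr (N z%:~R))); first exact: cvg_cst.
apply/funext => n /=; congr (ratr (N _)).
have e (k : nat) : (k%:R : padic_seq) n = k%:R.
  elim: k => // k IH; rewrite -[in RHS]natr1 -[in LHS]natr1.
  by rewrite -[LHS]/((k%:R : padic_seq) n + 1) IH.
case: z => k; first exact: e.
by rewrite NegzE !rmorphN -[LHS]/(- (k.+1%:R : padic_seq) n) e.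
Qed.

Lemma padic_abs_eq0 (R : realType) (x : padic) : (padic_abs R x == 0) = (x == 0).
Proof.
apply/eqP/eqP => [|->]; last first.
  by rewrite -[0]/(0%:~R : padic) padic_abs_int padic_norm0 rmorph0.
rewrite -[x]reprK; set u := repr x => u0; apply/eqP.
rewrite -[0](rmorph0 \pi_padic) padic_pi_eq subr0; apply: contraPT u0 => nu.
have [e e0 [K HK]] := padic_nonnull_bound nu.
apply/eqP; rewrite gt_eqF // (@lt_le_trans _ _ (ratr e)) ?ltr0q //.
apply: (ler_cvg_to (cvg_cst _) (@padic_absE R u)); near=> n.
by rewrite ler_rat HK //; near: n; exact: nbhs_infty_ge.
Unshelve. all: by end_near. Qed.

Lemma padic_absM (R : realType) (x y : padic) :
  padic_abs R (x * y) = padic_abs R x * padic_abs R y.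
Proof.
rewrite -[x]reprK -[y]reprK -rmorphM; apply: padic_abs_unique.
rewrite (_ : (fun n => _) =
  (fun n => ratr (N (repr x n)) * ratr (N (repr y n)) : R)); last first.
  by apply/funext => n; rewrite -rmorphM -padic_normM.
by apply: cvgM; exact: padic_absE.
Qed.

Lemma padic_absD (R : realType) (x y : padic) :
  padic_abs R (x + y) <= Num.max (padic_abs R x) (padic_abs R y).
Proof.
rewrite -[x]reprK -[y]reprK -rmorphD.
have cx := @padic_absE R (repr x); have cy := @padic_absE R (repr y).
have cm : ((Num.max (ratr (N (repr x n))) (ratr (N (repr y n))) : R) @[n --> \oo]
    --> Num.max (padic_abs R (\pi_padic (repr x)))
                (padic_abs R (\pi_padic (repr y))))%classic.
  under eq_fun do rewrite maxr_absE; rewrite maxr_absE.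
  exact: cvgM (cvgD (cvgD cx cy) (cvg_norm (cvgB cx cy))) (cvg_cst _).
apply: (ler_cvg_to (@padic_absE R (repr x + repr y)) cm).
by apply: nearW => n /=; rewrite le_max !ler_rat -le_max padic_normD.
Qed.

End PadicCauchy.

Section Tensors.
Variable K : fieldType.

Definition inner (d : nat) (a b : 'rV[K]_d) : K := \sum_(j < d) a 0 j * b 0 j.

(* (K^d)^{\otimes m}, in coordinates with respect to the basis
   e_{i_1} \otimes ... \otimes e_{i_m}, indexed by i : {ffun 'I_m -> 'I_d} *)
Definition tensor (d m : nat) := {ffun {ffun 'I_m -> 'I_d} -> K^o}.

Definition tens (d m : nat) (x : 'I_m -> 'rV[K]_d) : tensor d m :=
  [ffun i : {ffun 'I_m -> 'I_d} => \prod_(k < m) x k 0 (i k)].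

Definition tens_pow (d m : nat) (x : 'rV[K]_d) : tensor d m := tens (fun=> x).

Definition tensor_form (d m : nat) (S T : tensor d m) : K := \sum_i S i * T i.

Lemma tensor_form_tens (d m : nat) (x y : 'I_m -> 'rV[K]_d) :
  tensor_form (tens x) (tens y) = \prod_(k < m) inner (x k) (y k).
Proof.
rewrite /inner bigA_distr_bigA; apply: eq_bigr => i _.
by rewrite !ffunE -big_split.
Qed.

Definition symmetric_tensor (d m : nat) : {pred tensor d m} :=
  [pred T : tensor d m |
    [forall s : 'S_m, forall i : {ffun 'I_m -> 'I_d}, T [ffun k => i (s k)] == T i]].

End Tensors.

Arguments tensor : clear implicits.
Arguments symmetric_tensor : clear implicits.

(* Main.v *)
Require Import Defs.
From HB Require Import structures.
From mathcomp Require Import all_boot all_order all_fingroup all_algebra.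
From mathcomp Require Import all_classical all_reals all_analysis.

Import Order.TTheory GRing.Theory Num.Theory.
Local Open Scope ring_scope.

(** For a tight frame with constant b, write A for the sum of the
    inner products of the tau_j^{(x)m} with themselves and D for the dimension
    of the space of symmetric tensors. Taking the trace of the frame operator on
    symmetric tensors gives A = b D ([trace_symmetric_frame]); applying the
    operator to each tau_k^{(x)m} and pairing the result with tau_k^{(x)m} gives
    sum_{j,k} <tau_j, tau_k>^(2m) = b A. Eliminating b,
      D * sum_{j,k} <tau_j, tau_k>^(2m) = A^2        ([frame_welch_identity]).
    Splitting the double sum into its diagonal, kept as a single term, and its
    off-diagonal terms, the ultrametric inequality bounds its absolute value by
    the maximum in the theorem. One then divides by |D|, which is nonzero because
    Q_p has characteristic zero.

    The trace is computed in the basis of indicator functions of the classes of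
    multi-indices under permutation. Such a class is determined by its
    nondecreasing representative, so D counts the nondecreasing m-tuples in a
    d-element set, which is the binomial coefficient C(d + m - 1, m). *)

Section SymmetricTensors.
Variables (K : fieldType) (d m : nat).
Implicit Types (i : {ffun 'I_m -> 'I_d}) (t : m.-tuple 'I_d).

Definition ord_leq : rel 'I_d := relpre val leq.

Definition sorted_index i : m.-tuple 'I_d :=
  [tuple of sort ord_leq [tuple i k | k < m]].

Lemma ord_leq_total : total ord_leq.
Proof. by move=> x y; apply: leq_total. Qed.

Lemma ord_leq_trans : transitive ord_leq.
Proof. by move=> x y z; apply: leq_trans. Qed.

Lemma ord_leq_anti : antisymmetric ord_leq.
Proof. by move=> x y /anti_leq/val_inj. Qed.

(** Sorting picks a canonical multi-index in each orbit of the symmetric group,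
    so a tensor is symmetric exactly when its coordinates depend only on
    [sorted_index]. *)
Lemma sorted_indexP i i' :
  reflect (exists s : 'S_m, i = [ffun k => i' (s k)])
          (sorted_index i == sorted_index i').
Proof.
have sortP := perm_sortP ord_leq_total ord_leq_trans ord_leq_anti.
apply: (iffP eqP) => [/(congr1 val)/= /sortP | [s ->]].
  rewrite -[X in perm_eq _ X]/(val [tuple i' k | k < m]) => /tuple_permP[s E].
  have {}E : [tuple i k | k < m] = [tuple tnth [tuple i' k | k < m] (s k) | k < m].
    exact: val_inj.
  exists s; apply/ffunP => k; rewrite ffunE.
  by have := congr1 (fun t => tnth t k) E; rewrite !tnth_mktuple.
apply/val_inj/sortP.
rewrite -[X in perm_eq _ X]/(val [tuple i' k | k < m]).
apply/tuple_permP; exists s; congr val; apply: eq_mktuple => k.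
by rewrite tnth_mktuple ffunE.
Qed.

Lemma sorted_index_sorted i : sorted ord_leq (sorted_index i).
Proof. exact: sort_sorted ord_leq_total _. Qed.

Lemma sorted_index_tnth t :
  sorted ord_leq t -> sorted_index [ffun k => tnth t k] = t.
Proof.
move=> st; apply: val_inj.
rewrite /sorted_index; have -> : [tuple [ffun k => tnth t k] k | k < m] = t.
  by apply: eq_from_tnth => k; rewrite tnth_mktuple ffunE.
exact: (sorted_sort ord_leq_trans st).
Qed.

(** This cardinal is the dimension of Sym^m(K^d): its members index the basis
    [class_tensor]. *)
Lemma card_sorted_index : (0 < d)%N ->
  #|[set t : m.-tuple 'I_d | sorted ord_leq t]| = 'C(d + m - 1, m).
Proof.
rewrite /ord_leq; case: d => // d' _.
rewrite addSn subn1 /= addnC -card_sorted_tuples.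
by apply: eq_card => t; rewrite !inE sorted_map.
Qed.

Lemma tens_pow_symmetric (x : 'rV[K]_d) : tens_pow m x \in symmetric_tensor K d m.
Proof.
apply/forallP => s; apply/forallP => i; apply/eqP; rewrite !ffunE.
rewrite [RHS](reindex_inj (@perm_inj _ s)).
by apply: eq_bigr => k _; rewrite ffunE.
Qed.

Lemma symmetric_tensor_class (T : tensor K d m) i i' :
  T \in symmetric_tensor K d m -> sorted_index i = sorted_index i' -> T i = T i'.
Proof.
move=> /forallP symT /eqP/sorted_indexP[s ->].
by have /forallP/(_ i')/eqP := symT s.
Qed.

Definition class_tensor t : tensor K d m :=
  [ffun i => (sorted_index i == t)%:R].

Lemma class_tensor_symmetric t : class_tensor t \in symmetric_tensor K d m.
Proof.
apply/forallP => s; apply/forallP => i; rewrite !ffunE.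
suff -> : sorted_index [ffun k => i (s k)] = sorted_index i by [].
by apply/eqP/sorted_indexP; exists s.
Qed.

(** Both sides are the trace of the frame operator on Sym^m(K^d). To get its
    diagonal entry at a class t, evaluate the image of the indicator of t at the
    sorted representative of t: the result is b. As each v_j is constant on the
    class, it is also the sum over j and over i in the class of v_j(i)^2. The
    classes partition the multi-indices, so these entries add up to the sum of
    the forms of the v_j with themselves. *)
Lemma trace_symmetric_frame (n : nat) (v : 'I_n -> tensor K d m) (b : K) :
  (0 < d)%N ->
  (forall j, v j \in symmetric_tensor K d m) ->
  (forall x : tensor K d m, x \in symmetric_tensor K d m ->
     \sum_(j < n) tensor_form x (v j) *: v j = b *: x) ->
  \sum_(j < n) tensor_form (v j) (v j) = b * 'C(d + m - 1, m)%:R.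
Proof.
move=> d_gt0 symv frame.
have diag t : sorted ord_leq t ->
    \sum_(i | sorted_index i == t) \sum_(j < n) v j i * v j i = b.
  move=> st; pose i0 : {ffun 'I_m -> 'I_d} := [ffun k => tnth t k].
  have i0t : sorted_index i0 = t by exact: sorted_index_tnth.
  have := congr1 (fun T : tensor K d m => T i0) (frame _ (class_tensor_symmetric t)).
  rewrite sum_ffunE !ffunE i0t eqxx.
  rewrite -[b *: _]/(b * 1) mulr1 => <-.
  rewrite exchange_big; apply: eq_bigr => j _ /=.
  rewrite ffunE -[_ *: _]/(_ * _) mulr_suml big_mkcond; apply: eq_bigr => i _.
  rewrite ffunE; case: eqP => [it|_]; last by rewrite !mul0r.
  by rewrite mul1r (symmetric_tensor_class _ _ _ (symv j) (etrans it (esym i0t))).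
rewrite exchange_big /= (partition_big sorted_index (fun t => sorted ord_leq t)) /=;
  last by move=> i _; exact: sorted_index_sorted.
rewrite (eq_bigr _ diag) sumr_const -card_sorted_index // mulr_natr.
by congr (b *+ _); apply: eq_card => t; rewrite inE.
Qed.

Lemma tensor_form_pow (x y : 'rV[K]_d) :
  tensor_form (tens_pow m x) (tens_pow m y) = inner x y ^+ m.
Proof. by rewrite tensor_form_tens prodr_const card_ord. Qed.

(** The equality case of the Welch bound, valid over any field: both sides equal
    b times the dimension of Sym^m(K^d) times the trace
    sum_j <tau_j, tau_j>^m. *)
Lemma frame_welch_identity (n : nat) (tau : 'I_n -> 'rV[K]_d) (b : K) :
  (0 < d)%N ->
  (forall x : tensor K d m, x \in symmetric_tensor K d m ->
     \sum_(j < n) tensor_form x (tens_pow m (tau j)) *: tens_pow m (tau j)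
     = b *: x) ->
  'C(d + m - 1, m)%:R * (\sum_(k < n) \sum_(j < n) inner (tau k) (tau j) ^+ (2 * m))
  = (\sum_(j < n) inner (tau j) (tau j) ^+ m) ^+ 2.
Proof.
move=> d_gt0 frame.
have := trace_symmetric_frame n (fun j => tens_pow m (tau j)) b d_gt0
  (fun j => tens_pow_symmetric (tau j)) frame.
under eq_bigr do rewrite tensor_form_pow.
set A := \sum_(j < n) inner (tau j) (tau j) ^+ m => trA.
have pair k : \sum_(j < n) inner (tau k) (tau j) ^+ (2 * m)
    = b * inner (tau k) (tau k) ^+ m.
  have := congr1 (fun T => tensor_form T (tens_pow m (tau k)))
    (frame _ (tens_pow_symmetric (tau k))).
  have formZ c (S T : tensor K d m) : tensor_form (c *: S) T = c * tensor_form S T.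
    by rewrite mulr_sumr; apply: eq_bigr => i _; rewrite ffunE -mulrA.
  rewrite formZ tensor_form_pow => <-.
  under [RHS]eq_bigr do rewrite sum_ffunE mulr_suml.
  rewrite exchange_big; apply: eq_bigr => j _ /=.
  rewrite -[RHS]/(tensor_form (_ *: tens_pow m (tau j)) _) formZ !tensor_form_pow.
  have -> : inner (tau j) (tau k) = inner (tau k) (tau j).
    by apply: eq_bigr => l _; rewrite mulrC.
  by rewrite -exprD mul2n addnn.
under eq_bigr do rewrite pair.
by rewrite -mulr_sumr -/A mulrA [_ * b]mulrC -trA.
Qed.

End SymmetricTensors.

Section PadicAbs.
Variables (R : realType) (p : nat) (p_pr : prime p).
Local Notation abs := (@padic_abs p p_pr R).

Lemma padic_absX (x : padic p_pr) k : abs (x ^+ k) = abs x ^+ k.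
Proof.
elim: k => [|k IH]; last by rewrite !exprS padic_absM IH.
by rewrite -[x ^+ 0]/(1%:~R : padic p_pr) padic_abs_int padic_norm1 rmorph1.
Qed.

Lemma padic_abs_nat_gt0 k : (0 < k)%N -> 0 < abs k%:R.
Proof.
move=> k0; rewrite -[k%:R]/(k%:Z%:~R : padic p_pr) padic_abs_int ltr0q.
by rewrite padic_norm_gt0 // pnatr_eq0 -lt0n.
Qed.

(** The ultrametric inequality, with one summand singled out so that it can serve
    as the initial value of the maximum; here it will be the whole diagonal part
    of a double sum. *)
Lemma padic_abs_sum (I : finType) (P : pred I) (x : padic p_pr) (F : I -> padic p_pr) :
  abs (x + \sum_(i | P i) F i) <= \big[Num.max/abs x]_(i | P i) abs (F i).
Proof.
elim/big_rec2: _ => [|i M s _ le_sM]; first by rewrite addr0.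
rewrite addrCA (le_trans (padic_absD _ _ _)) //.
by rewrite ge_max !le_max lexx le_sM orbT.
Qed.

End PadicAbs.

Theorem theorem2p3 (R : realType) (p : nat) (p_pr : prime p) (n d m : nat)
    (n_gt0 : (0 < n)%N) (d_gt0 : (0 < d)%N) (m_gt0 : (0 < m)%N)
    (tau : 'I_n -> 'rV[padic p_pr]_d)
    (tau_tight : exists b : padic p_pr,
       forall x : tensor (padic p_pr) d m, x \in symmetric_tensor (padic p_pr) d m ->
         \sum_(j < n) tensor_form x (tens_pow m (tau j)) *: tens_pow m (tau j)
         = b *: x) :
  (\big[Num.max/padic_abs R (\sum_(l < n) inner (tau l) (tau l) ^+ (2 * m))]_
       (jk : 'I_n * 'I_n | jk.1 != jk.2)
         padic_abs R (inner (tau jk.1) (tau jk.2)) ^+ (2 * m)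
     >= 1 / padic_abs R ('C(d + m - 1, m)%:R : padic p_pr)
        * padic_abs R (\sum_(j < n) inner (tau j) (tau j) ^+ m) ^+ 2)
  /\ ((forall j : 'I_n, inner (tau j) (tau j) = 1) ->
      \big[Num.max/padic_abs R (n%:R : padic p_pr)]_
         (jk : 'I_n * 'I_n | jk.1 != jk.2)
           padic_abs R (inner (tau jk.1) (tau jk.2)) ^+ (2 * m)
        >= padic_abs R (n%:R : padic p_pr) ^+ 2
           / padic_abs R ('C(d + m - 1, m)%:R : padic p_pr)).
Proof.
have main : padic_abs R (\sum_(j < n) inner (tau j) (tau j) ^+ m) ^+ 2
      / padic_abs R ('C(d + m - 1, m)%:R : padic p_pr)
    <= \big[Num.max/padic_abs R (\sum_(l < n) inner (tau l) (tau l) ^+ (2 * m))]_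
       (jk : 'I_n * 'I_n | jk.1 != jk.2)
         padic_abs R (inner (tau jk.1) (tau jk.2)) ^+ (2 * m).
  have [b frame] := tau_tight.
  rewrite ler_pdivrMr; last first.
    by rewrite padic_abs_nat_gt0 // bin_gt0 -addnBAC // leq_addl.
  rewrite -padic_absX -(frame_welch_identity _ _ _ _ _ _ d_gt0 frame) padic_absM mulrC.
  rewrite ler_wpM2r //.
    by rewrite ltW // padic_abs_nat_gt0 // bin_gt0 -addnBAC // leq_addl.
  under [leRHS]eq_bigr do rewrite -padic_absX.
  apply: le_trans (padic_abs_sum _ _ _ _ _ _ _); rewrite pair_big /=.
  rewrite (bigID (fun jk : 'I_n * 'I_n => jk.1 == jk.2)) /=.
  suff -> : \sum_(jk : 'I_n * 'I_n | jk.1 == jk.2) inner (tau jk.1) (tau jk.2) ^+ (2 * m)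
      = \sum_(l < n) inner (tau l) (tau l) ^+ (2 * m) by [].
  rewrite -(pair_big_dep xpredT (fun j k => j == k)
    (fun j k => inner (tau j) (tau k) ^+ (2 * m))) /=.
  by apply: eq_bigr => j _; rewrite (big_pred1 j) // => k; rewrite eq_sym.
split=> [|unit_tau]; first by rewrite mul1r mulrC.
have sum1 k : \sum_(j < n) inner (tau j) (tau j) ^+ k = n%:R.
  under eq_bigr do rewrite unit_tau expr1n.
  by rewrite sumr_const card_ord.
by move: main; rewrite !sum1.
Qed.
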